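(* Let $P$ be a property of positive integers. For a property $Q$ let $f_Q(n)$ denote the $n$-th smallest positive integer $m$ such that $Q(m)$ holds. Suppose infinitely many positive integers fail $P$ and $f_{\neg P}(m+1)-f_{\neg P}(m)\geq m$ for all positive integers $m$. Let $\alpha$ be a real-valued increasing function on the positive integers with $\alpha(1)=1$ and $f_{\neg P}(m-1)\le\alpha(m)\le f_{\neg P}(m)$ for all positive integers $m$ (the left inequality being required for $m\ge 2$), and define $h(n)=\max\{m\in\mathbb{N}^+:\alpha(m)\le n\}$. Then for every positive integer $n$, $$f_P(n)=\begin{cases} n+h(n)+1 & \text{if } n+h(n)\geq f_{\neg P}(h(n)+1),\\ n+h(n)-1 & \text{if } n+h(n)\leq f_{\neg P}(h(n)),\\ n+h(n) & \text{otherwise.}\end{cases}$$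
   Context: $\neg P$ denotes the negation of $P$; thus $f_{\neg P}(n)$ is the $n$-th smallest positive integer not satisfying $P$. $\mathbb{N}^+$ is the set of positive integers. *)

(* Defs.v *)
From HB Require Import structures.
From mathcomp Require Import all_boot all_order all_algebra.
From mathcomp Require Import all_classical all_reals.

Set Implicit Arguments.
Unset Strict Implicit.
Unset Printing Implicit Defensive.

Import Order.TTheory GRing.Theory Num.Theory.

Local Open Scope classical_set_scope.
Local Open Scope ring_scope.

(* Properties and functions of positive integers are given on nat; their
   behaviour at 0 is never consulted. *)

(* Only satisfiable for 0 < n, since m itself is counted. *)
Definition is_nth_smallest (Q : nat -> Prop) (n m : nat) : Prop :=
  [/\ (0 < m)%N, Q m & count (fun k => `[< Q k >]) (index_iota 1 m.+1) = n].

(* The default value 0 cannot be mistaken for an n-th smallest positive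
   integer: f_ Q n = m with 0 < m entails is_nth_smallest Q n m. *)
Definition f_ (Q : nat -> Prop) (n : nat) : nat :=
  xget 0%N [set m | is_nth_smallest Q n m].

Definition negp (P : nat -> Prop) : nat -> Prop := fun m => ~ P m.

(* The default value 0 lies outside the set whose maximum is taken. *)
Definition max_index (R : realType) (alpha : nat -> R) (n : nat) : nat :=
  let A := [set m : nat | (0 < m)%N /\ alpha m <= n%:R] in
  xget 0%N [set m | A m /\ forall k, A k -> (k <= m)%N].

(* Main.v *)
Require Import Defs.
From HB Require Import structures.
From mathcomp Require Import all_boot all_order all_algebra.
From mathcomp Require Import all_classical all_reals.
From mathcomp Require Import zify.

Set Implicit Arguments.
Unset Strict Implicit.
Unset Printing Implicit Defensive.

Import Order.TTheory GRing.Theory Num.Theory.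

Local Open Scope classical_set_scope.
Local Open Scope ring_scope.

(* Write g for f_ (negp P), with g 0 = 0. If g k < m < g (k + 1), then m
   satisfies P and exactly k of 1, ..., m fail P, so m is the (m - k)-th
   positive integer satisfying P. The definition of h gives
   g (h n - 1) <= n < g (h n + 1), and the gap condition pushes g (h n + 2)
   above n + h n + 1; so in the three cases n + h n + 1, n + h n - 1 and
   n + h n lie strictly between consecutive values of g, with k = h n + 1,
   h n - 1 and h n respectively. *)

Definition counting (Q : nat -> Prop) (m : nat) : nat :=
  count (fun k => `[< Q k >]) (index_iota 1 m.+1).

Section Counting.
Variable Q : nat -> Prop.
Implicit Types m n : nat.

Lemma countingS m : counting Q m.+1 = (counting Q m + `[< Q m.+1 >])%N.
Proof.
rewrite /counting /index_iota !subn1 -[m.+2.-1]/(m.+1) -{1}(addn1 m) iotaD.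
by rewrite count_cat /= addn0 add1n.
Qed.

Lemma counting_leq m n : (m <= n)%N -> (counting Q m <= counting Q n)%N.
Proof.
move=> /subnKC <-; elim: (n - m)%N => [|d IHd]; first by rewrite addn0.
by rewrite addnS countingS (leq_trans IHd) ?leq_addr.
Qed.

Lemma counting_ltn m n : (m < n)%N -> Q n -> (counting Q m < counting Q n)%N.
Proof.
case: n => // n; rewrite ltnS => le_mn Qn.
by rewrite countingS asboolT // addn1 ltnS counting_leq.
Qed.

Lemma counting_le_id m : (counting Q m <= m)%N.
Proof.
by rewrite /counting (leq_trans (count_size _ _)) // size_iota subn1.
Qed.

Lemma counting_negp m : (counting Q m + counting (negp Q) m)%N = m.
Proof.
have := count_predC (fun k => `[< Q k >]) (index_iota 1 m.+1).
rewrite size_iota subn1 /= => cE; rewrite -[RHS]cE; congr addn.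
by apply: eq_count => k; rewrite /= -asbool_neg.
Qed.

(** The count rises strictly on reaching a point where [Q] holds, so two distinct such points cannot
    share the count [n]. *)
Lemma f_E n m : is_nth_smallest Q n m -> f_ Q n = m.
Proof.
move=> Hm; apply: xget_unique => // m' [m'_gt0 Qm' cm'].
case: Hm => m_gt0 Qm cm; case: (ltngtP m m') => // lt_mm.
- by have := counting_ltn lt_mm Qm'; rewrite /counting cm cm' ltnn.
- by have := counting_ltn lt_mm Qm; rewrite /counting cm cm' ltnn.
Qed.

(** An [m] satisfying [Q] counts itself, so no [m] has rank 0 and [xget] returns its default. *)
Lemma f_0 : f_ Q 0 = 0%N.
Proof.
rewrite /f_; case: xgetP => // m _ [m_gt0 Qm cm].
by have := counting_ltn m_gt0 Qm; rewrite /(counting Q m) cm ltn0.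
Qed.

Hypothesis infQ : infinite_set [set m : nat | (0 < m)%N /\ Q m].

Lemma counting_unbounded n : exists m, (n <= counting Q m)%N.
Proof.
elim: n => [|n [m le_n]]; first by exists 0%N.
have [m' [lt_mm' Qm']] : exists m', (m < m')%N /\ Q m'.
  (* Otherwise every point satisfying [Q] would be at most [m]. *)
  apply: contrapT => noQ; apply: infQ.
  apply: (sub_finite_set (B := `I_m.+1)); last exact: finite_II.
  move=> k [_ Qk] /=; rewrite ltnS leqNgt; apply/negP => lt_mk.
  by apply: noQ; exists k.
by exists m'; apply: leq_ltn_trans le_n (counting_ltn lt_mm' Qm').
Qed.

(** The witness is the least [m] whose count reaches [n]: each step adds at most 1 to the count, so
    it is exactly [n] there, and the last step adds 1 only if [Q] holds at [m]. *)
Lemma f_is_nth n : (0 < n)%N -> is_nth_smallest Q n (f_ Q n).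
Proof.
move=> n_gt0; suff [m Hm] : exists m, is_nth_smallest Q n m.
  by rewrite (f_E Hm).
have [[|m] le_n min_m] := ex_minnP (counting_unbounded n).
  by move: (leq_trans n_gt0 le_n); rewrite ltn0.
have lt_n : (counting Q m < n)%N.
  by rewrite ltnNge; apply/negP => /min_m; rewrite ltnn.
exists m.+1; move: le_n; rewrite countingS.
case: (asboolP (Q m.+1)) => [Qm|nQm] le_n; last by move: lt_n le_n; lia.
split=> //; rewrite -/(counting Q m.+1) countingS asboolT //.
by move: lt_n le_n; lia.
Qed.

Lemma counting_f n : counting Q (f_ Q n) = n.
Proof.
by case: n => [|n]; [rewrite f_0 | case: (f_is_nth (ltn0Sn n))].
Qed.

Lemma f_ge_id n : (n <= f_ Q n)%N.
Proof. by rewrite -{1}(counting_f n) counting_le_id. Qed.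

End Counting.

Lemma f_between (P : nat -> Prop) (k m : nat) :
  infinite_set [set m : nat | (0 < m)%N /\ ~ P m] ->
  (f_ (negp P) k < m < f_ (negp P) k.+1)%N -> f_ P (m - k) = m.
Proof.
move=> infNP /andP[lt_gm lt_mg]; apply: f_E.
(* Monotonicity from [f_ (negp P) k] gives at least [k]; strict growth at [f_ (negp P) k.+1] gives
   less than [k.+1]. *)
have ck : counting (negp P) m = k.
  have [_ NPg _] := f_is_nth (Q := negp P) infNP (ltn0Sn k).
  have := counting_leq (negp P) (ltnW lt_gm); have := counting_ltn lt_mg NPg.
  by rewrite !(@counting_f (negp P)) //; lia.
split.
- exact: leq_ltn_trans (leq0n _) lt_gm.
- apply: contrapT => NPm.
  by have := counting_ltn (Q := negp P) lt_gm NPm; rewrite ck counting_f // ltnn.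
- by rewrite -/(counting P m) -{2}(counting_negp P m) ck addnK.
Qed.

(** The index 1 and the bound [b] ensure that the maximum exists, which rules out the default 0; the
    last inequality is maximality. *)
Lemma max_indexP (R : realType) (alpha : nat -> R) (n b : nat) :
  alpha 1%N <= n%:R ->
  (forall m, (0 < m)%N -> alpha m <= n%:R -> (m <= b)%N) ->
  [/\ (0 < max_index alpha n)%N, alpha (max_index alpha n) <= n%:R
    & n%:R < alpha (max_index alpha n).+1].
Proof.
move=> alpha1 bounded; rewrite /max_index.
pose A m := (0 < m)%N && (alpha m <= n%:R).
have exA : exists m, A m by exists 1%N.
have leA m : A m -> (m <= b)%N by case/andP; exact: bounded.
have [m /andP[m_gt0 le_m] max_m] := ex_maxnP exA leA.
case: xgetP => [h _ [[h_gt0 le_h] max_h]|/(_ m) []].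
  by split=> //; rewrite ltNge; apply/negP => le_h1; have := max_h h.+1;
     rewrite ltnn => /(_ (conj isT le_h1)).
by split=> // k [k_gt0 le_k]; apply: max_m; apply/andP.
Qed.

Theorem theorem3 (R : realType) (P : nat -> Prop) (alpha : nat -> R)
  (infNP : infinite_set [set m : nat | (0 < m)%N /\ ~ P m])
  (gapNP : forall m : nat, (0 < m)%N ->
     (m%:Z <= (f_ (negp P) m.+1)%:Z - (f_ (negp P) m)%:Z)%R)
  (alpha_incr : forall m1 m2 : nat, (0 < m1)%N -> (m1 <= m2)%N ->
     alpha m1 <= alpha m2)
  (alpha1 : alpha 1%N = 1)
  (alpha_lower : forall m : nat, (2 <= m)%N ->
     (f_ (negp P) m.-1)%:R <= alpha m)
  (alpha_upper : forall m : nat, (0 < m)%N ->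
     alpha m <= (f_ (negp P) m)%:R)
  (n : nat) (n_gt0 : (0 < n)%N) :
  let h := max_index alpha in
  [/\ (f_ (negp P) (h n).+1 <= n + h n)%N -> f_ P n = (n + h n + 1)%N,
      (n + h n <= f_ (negp P) (h n))%N -> f_ P n = (n + h n - 1)%N
    & ~~ (f_ (negp P) (h n).+1 <= n + h n)%N ->
      ~~ (n + h n <= f_ (negp P) (h n))%N -> f_ P n = (n + h n)%N].
Proof.
move=> h; set g := f_ (negp P) in gapNP alpha_lower alpha_upper *.
have gap m : (0 < m)%N -> (g m + m <= g m.+1)%N by move=> /gapNP; lia.
(* The bound [n.+1] comes from [m.+1 <= g m.+1 <= alpha m.+2 <= n]. *)
have [] := @max_indexP R alpha n n.+1.
- by rewrite alpha1 ler1n.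
- case=> [|[|m]] // _ le_n; rewrite ltnS.
  have := le_trans (alpha_lower m.+2 isT) le_n; rewrite ler_nat.
  by apply: leq_trans; apply: f_ge_id.
(* From here [h n] is [k.+1], so [g k] stands for the value of [g] at [h n - 1]. *)
rewrite -/(h n); case: (h n) => // k _ le_n gt_n.
have g0 : g 0%N = 0%N by apply: f_0.
have lt_ng : (n < g k.+2)%N.
  by rewrite -(ltr_nat R); apply: lt_le_trans gt_n (alpha_upper _ _).
have le_gn : (g k <= n)%N.
  case: k le_n {gt_n lt_ng} => [|k] le_n; first by rewrite g0.
  by rewrite -(ler_nat R); apply: le_trans (alpha_lower k.+2 isT) le_n.
have between j : (g j < n + j < g j.+1)%N -> f_ P n = (n + j)%N.
  by move=> /(f_between infNP); rewrite addnK.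
split=> [ge_g|le_g|lt_g gt_g].
(* Adding [n < g k.+2] to the gap at [k.+2] gives [n + k.+2 < g k.+3]. *)
- by rewrite -addnA addn1; apply: between; have := gap k.+2 isT; lia.
- rewrite addnS subn1 /=.
  (* The lower bound [g k < n + k] follows from [g k <= n] only for positive [k]; for [k = 0] it is
     [0 < n]. *)
  case: k le_gn le_g {le_n gt_n lt_ng} => [|k] le_gn le_g.
    by apply: between; rewrite g0; lia.
  by apply: between; lia.
- by apply: between; lia.
Qed.
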